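(* Let $n\ge 2$ and let $X=\mathbb{C}^n\setminus\{(0,\ldots,0)\}$. There exist infinite discrete subsets of $X$ which cannot be realized as the union of finitely many tame discrete subsets of $X$.
   Context: A discrete subset of a complex manifold $X$ is a subset without accumulation points in $X$. An automorphism of $X$ is a biholomorphic self-map of $X$. An exhaustion function on $X$ is a continuous function $\rho:X\to\mathbb{R}^+$ (non-negative reals) all of whose sublevel sets $\{x\in X:\rho(x)\le c\}$ are compact. An infinite discrete subset $D\subset X$ is called tame if for every exhaustion function $\rho:X\to\mathbb{R}^+$ and every map $\zeta:D\to\mathbb{R}^+$ there exists an automorphism $\phi$ of $X$ such that $\rho(\phi(x))\ge\zeta(x)$ for all $x\in D$. *)

(* Defs.v *)
From mathcomp Require Import all_boot all_order all_algebra.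
From mathcomp Require Import all_classical all_reals all_analysis.
From mathcomp Require Import complex.
Set Implicit Arguments.
Unset Strict Implicit.
Unset Printing Implicit Defensive.
Import Order.TTheory GRing.Theory Num.Theory.
Import numFieldNormedType.Exports.
Local Open Scope ring_scope.
Local Open Scope classical_set_scope.

(* The ascription to numFieldType is what gives access to the topology that
   mathcomp-analysis puts on a numFieldType (by its norm), hence to the sup-norm
   structure of normed module over R[i] on row vectors. *)
Notation Cvec R n := 'rV[(R[i] : numFieldType)]_n (only parsing).

(* A complex manifold is here an open subset X of C^n. Maps defined on X, or on
   a subset D of X, are total functions, constrained and used only there. *)

(* Since Cvec R n is a normed module over R[i], differentiability is complex
   Frechet differentiability, hence holomorphy when X is open. *)
Definition holomorphic_on (R : realType) (n m : nat) (X : set (Cvec R n))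
    (f : Cvec R n -> Cvec R m) : Prop :=
  forall x, X x -> differentiable f x.

Definition automorphism (R : realType) (n : nat) (X : set (Cvec R n))
    (phi : Cvec R n -> Cvec R n) : Prop :=
  [/\ holomorphic_on X phi, (forall x, X x -> X (phi x)) &
    exists psi : Cvec R n -> Cvec R n,
      [/\ holomorphic_on X psi, (forall x, X x -> X (psi x)),
          (forall x, X x -> psi (phi x) = x) &
          (forall x, X x -> phi (psi x) = x)]].

(* Only accumulation points inside X are excluded: D may accumulate at the
   boundary of X. *)
Definition discrete_in (R : realType) (n : nat) (X D : set (Cvec R n)) : Prop :=
  D `<=` X /\ forall x, X x -> ~ limit_point D x.

Definition exhaustion (R : realType) (n : nat) (X : set (Cvec R n))
    (rho : Cvec R n -> R) : Prop :=
  [/\ (forall x, X x -> 0 <= rho x), {within X, continuous rho} &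
      forall c : R, compact [set x | X x /\ rho x <= c]].

Definition tame (R : realType) (n : nat) (X D : set (Cvec R n)) : Prop :=
  [/\ infinite_set D, discrete_in X D &
    forall rho : Cvec R n -> R, exhaustion X rho ->
    forall zeta : Cvec R n -> R, (forall x, D x -> 0 <= zeta x) ->
    exists phi : Cvec R n -> Cvec R n,
      automorphism X phi /\ forall x, D x -> zeta x <= rho (phi x)].

(* Main.v *)
Require Import Defs.
From mathcomp Require Import all_boot all_order all_algebra.
From mathcomp Require Import all_classical all_reals all_analysis.
From mathcomp Require Import complex ring lra zify.
Set Implicit Arguments.
Unset Strict Implicit.
Unset Printing Implicit Defensive.
Import Order.TTheory GRing.Theory Num.Theory.
Import numFieldNormedType.Exports.
Local Open Scope ring_scope.
Local Open Scope classical_set_scope.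

(** A sequence D converging to the origin is discrete in X = C^n minus the
    origin, and no infinite subset of it is tame; as tame sets are infinite,
    D is then not a finite union of tame sets. Tameness fails because, for
    n >= 2, an automorphism phi of X cannot push points near the origin towards
    the ends of X faster than an a priori rate. Classically, phi and its
    inverse psi extend over the origin by Hartogs' theorem, and psi is then
    Lipschitz there, so that phi shrinks distances to the origin by at most a
    constant factor. The proof below extracts just two quantitative facts from
    this picture, both read off on complex lines that avoid the origin.

    - A holomorphic map on X is bounded on the punctured unit ball
      ([holomorphic_bounded]): through each point y of the ball there is a line
      avoiding the origin, and the maximum principle bounds the map at y by its
      values on the part of the line lying in a fixed compact shell.
    - A holomorphic map on X is Hoelder continuous of exponent 1/2 near the
      origin ([hoelder_near0]), again by restriction to lines.

    Take D to be the points x_k = 2^-k e_i, the exhaustion |x| + 1/|x| and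
    zeta(x) = |x|^-3. If phi realizes zeta on T, put y_k = phi(x_k). Since
    |y_k| stays bounded, the growth of the exhaustion must come from 1/|y_k|,
    whence |y_k| <= 2|x_k|^3. Then for k < l the Hoelder bound for psi gives
    |x_k|^2 / 4 <= |x_k - x_l|^2 <= L |y_k - y_l| <= 4 L |x_k|^3, which fails
    for k large ([dyadic_not_tame]).

    On the line, what is needed is a maximum principle with some absolute
    constant ([max_principle]) for functions that are merely complex
    differentiable at every point, hence a form of Goursat's theorem. It is
    stated without integrals: contour integrals are replaced by trapezoidal
    sums over the dyadic_pt subdivisions of the sides of a square, which are exact
    on affine functions and additive under quadrisection, and [goursat] says
    that these sums tend to 0. Removable singularities never occur, because the
    theorem is applied to (f(s) - f(c))^2 / (s - c): the square makes this
    quotient differentiable at c too ([square_quot_differentiable]). For c = 0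
    its contour sums yield a quadratic inequality for |f(0)|, and for c = 1 its
    modulus at 0 is |f(0) - f(1)|^2. *)

(** * Real-valued moduli and trapezoidal sums *)

Section Modulus.
Variables (R : realType) (V : normedZmodType R[i]).
Implicit Types x y : V.

(** The norm of a vector over [R[i]] is a complex number; its real part lets
    the estimates take place in the ordered field [R]. *)
Definition modulus x : R := complex.Re `|x|.

Lemma modulusE x : `|x| = (modulus x)%:C%C.
Proof. by rewrite /modulus RRe_real // normr_real. Qed.

Lemma modulus_ge0 x : 0 <= modulus x.
Proof. by rewrite -ler0c -modulusE. Qed.

Lemma modulus_eq0 x : (modulus x == 0) = (x == 0).
Proof.
rewrite -(normr_eq0 x) modulusE.
by apply/eqP/eqP => [->//|[]].
Qed.

Lemma modulus0 : modulus 0 = 0.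
Proof. by apply/eqP; rewrite modulus_eq0. Qed.

Lemma modulus_gt0 x : (0 < modulus x) = (x != 0).
Proof. by rewrite lt_neqAle modulus_ge0 andbT eq_sym modulus_eq0. Qed.

Lemma modulusD x y : modulus (x + y) <= modulus x + modulus y.
Proof. by rewrite -lecR rmorphD /= -!modulusE ler_normD. Qed.

Lemma modulusN x : modulus (- x) = modulus x.
Proof. by rewrite /modulus normrN. Qed.

Lemma modulusB x y : modulus (x - y) <= modulus x + modulus y.
Proof. by rewrite -(modulusN y) modulusD. Qed.

Lemma modulus_distC x y : modulus (x - y) = modulus (y - x).
Proof. by rewrite -modulusN opprB. Qed.

End Modulus.

Section ModulusScalar.
Variable R : realType.
Implicit Types x y : R[i].

Lemma modulusM x y : modulus (x * y) = modulus x * modulus y.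
Proof. by apply: complexI; rewrite rmorphM /= -!modulusE normrM. Qed.

Lemma modulusV x : modulus x^-1 = (modulus x)^-1.
Proof. by apply: complexI; rewrite fmorphV /= -!modulusE normfV. Qed.

Lemma modulus_real (a : R) : modulus (a%:C%C) = `|a|.
Proof. by apply: complexI; rewrite -modulusE normc_def /= expr0n addr0 sqrtr_sqr. Qed.

Lemma modulus_i : modulus ('i%C : R[i]) = 1.
Proof. by apply: complexI; rewrite -modulusE normc_def /= expr0n add0r expr1n sqrtr1. Qed.

Lemma modulus_Re x : `|complex.Re x| <= modulus x.
Proof. by rewrite -lecR -modulusE normc_ge_Re. Qed.

Lemma modulus_Im x : `|complex.Im x| <= modulus x.
Proof.
have := modulus_Re (x * 'i%C).
by rewrite ReiNIm normrN modulusM modulus_i mulr1.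
Qed.

Lemma modulus_le_ReIm x : modulus x <= `|complex.Re x| + `|complex.Im x|.
Proof.
rewrite {1}(complexE x); apply: le_trans (modulusD _ _) _.
by rewrite modulusM modulus_i mul1r !modulus_real.
Qed.

End ModulusScalar.

Section TrapezoidSums.
Variable R : realType.
Local Notation C := R[i].
Implicit Types (f g : C -> C) (z u w : C).

(** Composite trapezoidal rule with [2 ^ N] steps for the integral of [g] along
    the segment from [z] to [z + u]. *)
Fixpoint segsum g N z u : C :=
  if N is N'.+1 then segsum g N' z (u / 2) + segsum g N' (z + u / 2) (u / 2)
  else u * (g z + g (z + u)) / 2.

Lemma segsumS g N z w :
  segsum g N.+1 z (w + w) = segsum g N z w + segsum g N (z + w) w.
Proof. by rewrite /=; have -> : (w + w) / 2 = w by field. Qed.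

Lemma segsumD f g N z u :
  segsum (fun s => f s + g s) N z u = segsum f N z u + segsum g N z u.
Proof. by elim: N z u => [|N IH] z u /=; rewrite ?IH; ring. Qed.

Lemma segsumZ a g N z u : segsum (fun s => a * g s) N z u = a * segsum g N z u.
Proof. by elim: N z u => [|N IH] z u /=; rewrite ?IH; ring. Qed.

(** Thanks to this exactness, the affine part of a function near a point will
    drop out of its contour sums with no error, whatever [N]. *)
Lemma segsum_affine a b N z u :
  segsum (fun s => a * s + b) N z u = u * (a * (z + u / 2) + b).
Proof.
elim: N z u => [|N IH] z u /=; rewrite ?IH; field.
all: by [].
Qed.

Lemma modulus_half u : modulus (u / 2) = modulus u / 2.
Proof.
have -> : (2 : C) = (2 : R)%:C%C by rewrite rmorph_nat.
by rewrite modulusM modulusV modulus_real ger0_norm.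
Qed.

Lemma half_point (t : R) u : t%:C%C * (u / 2) = (t / 2)%:C%C * u.
Proof. by rewrite rmorphM fmorphV rmorph_nat; field. Qed.

Lemma half_point_shift (t : R) u : u / 2 + t%:C%C * (u / 2) = ((1 + t) / 2)%:C%C * u.
Proof. by rewrite rmorphM fmorphV rmorphD rmorph1 rmorph_nat; field. Qed.

Lemma segsum_bound g N z u (M : R) :
  (forall t : R, 0 <= t <= 1 -> modulus (g (z + t%:C%C * u)) <= M) ->
  modulus (segsum g N z u) <= modulus u * M.
Proof.
elim: N z u => [|N IH] z u gM /=.
  have := gM 0; have := gM 1.
  rewrite rmorph0 mul0r addr0 rmorph1 mul1r !lexx !ler01 /= => /(_ isT) g1 /(_ isT) g0.
  rewrite modulus_half modulusM -mulrA ler_wpM2l ?modulus_ge0 //.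
  have := modulusD (g z) (g (z + u)); lra.
have H1 := IH z (u / 2); have H2 := IH (z + u / 2) (u / 2).
rewrite modulus_half in H1 H2.
apply: le_trans (modulusD _ _) _.
have -> : modulus u * M = modulus u / 2 * M + modulus u / 2 * M by field.
apply: lerD.
  by apply: H1 => t t01; rewrite half_point; apply: gM; lra.
by apply: H2 => t t01; rewrite -addrA half_point_shift; apply: gM; lra.
Qed.

Lemma segsum_Im_ge g N z u (c : R) :
  (forall t : R, 0 <= t <= 1 -> c <= complex.Im (u * g (z + t%:C%C * u))) ->
  c <= complex.Im (segsum g N z u).
Proof.
have ImD (a b : C) : complex.Im (a + b) = complex.Im a + complex.Im b by case: a b => [? ?] [].
have Imh (a : C) : complex.Im (a / 2) = complex.Im a / 2.
  have -> : (2 : C) = (2 : R)%:C%C by rewrite rmorph_nat.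
  by case: a => a b /=; field.
elim: N z u c => [|N IH] z u c gc /=.
  have := gc 0; have := gc 1.
  rewrite rmorph0 mul0r addr0 rmorph1 mul1r !lexx !ler01 /= => /(_ isT) g1 /(_ isT) g0.
  by rewrite mulrDr Imh ImD; lra.
have -> : c = c / 2 + c / 2 by field.
rewrite ImD; apply: lerD; apply: IH => t t01.
  by rewrite half_point mulrAC Imh; have := gc (t / 2); lra.
by rewrite -addrA half_point_shift mulrAC Imh; have := gc ((1 + t) / 2); lra.
Qed.

(** Approximate contour integral along the counterclockwise boundary of the
    square with corners [z], [z + u], [z + u + 'i * u], [z + 'i * u]; the last
    two sides are traversed backwards, hence the signs. *)
Definition sqsum g N z u : C :=
  segsum g N z u + segsum g N (z + u) ('i%C * u)
  - segsum g N (z + 'i%C * u) u - segsum g N z ('i%C * u).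

(** The contributions of the four inner sides cancel in pairs, exactly as for
    integrals: this is what makes Goursat's bisection work on the sums. *)
Lemma sqsumS g N z w :
  sqsum g N.+1 z (w + w) =
  sqsum g N z w + sqsum g N (z + w) w + sqsum g N (z + 'i%C * w) w +
  sqsum g N (z + w + 'i%C * w) w.
Proof.
rewrite /sqsum !mulrDr !segsumS !addrA.
set v := 'i%C * w.
have -> : z + v + v + w = z + w + v + v by ring.
have -> : z + v + w = z + w + v by ring.
have -> : z + w + v + w = z + w + w + v by ring.
ring.
Qed.

Lemma sqsum_affine a b N z u : sqsum (fun s => a * s + b) N z u = 0.
Proof. by rewrite /sqsum !segsum_affine; field. Qed.

End TrapezoidSums.

(** * Goursat's theorem for trapezoidal sums *)

Section Goursat.
Variable R : realType.
Local Notation C := R[i].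
Implicit Types (f g : C -> C) (z u w : C).

Lemma sqsum_bound g N z u (M : R) :
  (forall x y : R, 0 <= x <= 1 -> 0 <= y <= 1 ->
     [|| x == 0, x == 1, y == 0 | y == 1] ->
     modulus (g (z + (x +i* y)%C * u)) <= M) ->
  modulus (sqsum g N z u) <= 4 * modulus u * M.
Proof.
move=> gM; rewrite /sqsum.
have iE (t : R) : (t%:C%C * ('i%C * u)) = (0 +i* t)%C * u.
  by rewrite mulrA; congr (_ * u); apply/eqP; rewrite eq_complex /=; apply/andP; split; apply/eqP; ring.
have e1 : u = (1 +i* 0)%C * u by rewrite -[LHS]mul1r.
have H1 : modulus (segsum g N z u) <= modulus u * M.
  by apply: segsum_bound => t t01; apply: (gM t 0); rewrite ?lexx ?ler01 ?eqxx ?orbT.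
have H2 : modulus (segsum g N (z + u) ('i%C * u)) <= modulus u * M.
  have -> : modulus u = modulus ('i%C * u) by rewrite modulusM modulus_i mul1r.
  apply: segsum_bound => t t01.
  rewrite iE -addrA {1}e1 -mulrDl.
  have -> : ((1 +i* 0) + (0 +i* t) = 1 +i* t :> C)%C by congr Complex; ring.
  by apply: gM; rewrite ?lexx ?ler01 ?eqxx ?orbT.
have H3 : modulus (segsum g N (z + 'i%C * u) u) <= modulus u * M.
  apply: segsum_bound => t t01.
  rewrite -addrA -mulrDl.
  have -> : ((0 +i* 1) + t%:C = t +i* 1 :> C)%C by congr Complex; ring.
  by apply: gM; rewrite ?lexx ?ler01 ?eqxx ?orbT.
have H4 : modulus (segsum g N z ('i%C * u)) <= modulus u * M.
  have -> : modulus u = modulus ('i%C * u) by rewrite modulusM modulus_i mul1r.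
  apply: segsum_bound => t t01; rewrite iE.
  by apply: gM; rewrite ?lexx ?ler01 ?eqxx ?orbT.
have := modulusB (segsum g N z u + segsum g N (z + u) ('i%C * u) - segsum g N (z + 'i%C * u) u) (segsum g N z ('i%C * u)).
have := modulusB (segsum g N z u + segsum g N (z + u) ('i%C * u)) (segsum g N (z + 'i%C * u) u).
have := modulusD (segsum g N z u) (segsum g N (z + u) ('i%C * u)).
lra.
Qed.

Lemma sqsumD f g N z u :
  sqsum (fun s => f s + g s) N z u = sqsum f N z u + sqsum g N z u.
Proof. by rewrite /sqsum !segsumD; ring. Qed.

Lemma sqsumZ a g N z u : sqsum (fun s => a * g s) N z u = a * sqsum g N z u.
Proof. by rewrite /sqsum !segsumZ; ring. Qed.

(** Differentiability at [z] with an explicit radius, the form in which the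
    bisection argument consumes it; see [cderivableP]. *)
Definition cderivable g z := exists d : C, forall e : R, 0 < e ->
  exists2 r : R, 0 < r & forall s, modulus (s - z) < r ->
    modulus (g s - g z - d * (s - z)) <= e * modulus (s - z).

(** The bound is proportional to the area of the square, so that it passes from
    the four quarters of a square to the square itself. *)
Definition sqsum_small g (e : R) z u :=
  exists N0, forall N, (N0 <= N)%N -> modulus (sqsum g N z u) <= e * modulus u ^+ 2.

Lemma sqsum_small_quadrisect g e z w :
  sqsum_small g e z w -> sqsum_small g e (z + w) w ->
  sqsum_small g e (z + 'i%C * w) w -> sqsum_small g e (z + w + 'i%C * w) w ->
  sqsum_small g e z (w + w).
Proof.
move=> [N1 H1] [N2 H2] [N3 H3] [N4 H4].
exists (N1 + N2 + N3 + N4).+1 => -[//|N] leN.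
rewrite sqsumS.
have {}H1 := H1 N ltac:(lia); have {}H2 := H2 N ltac:(lia).
have {}H3 := H3 N ltac:(lia); have {}H4 := H4 N ltac:(lia).
have -> : modulus (w + w) = 2 * modulus w.
  have -> : w + w = (2 : R)%:C%C * w by rewrite rmorph_nat; ring.
  by rewrite modulusM modulus_real ger0_norm.
set a := sqsum g N z w in H1 *; set b := sqsum g N (z + w) w in H2 *.
set c := sqsum g N (z + 'i%C * w) w in H3 *.
set d := sqsum g N (z + w + 'i%C * w) w in H4 *.
have := modulusD (a + b + c) d; have := modulusD (a + b) c; have := modulusD a b.
lra.
Qed.

(** Near a point of differentiability [g] is affine up to an error that is
    small compared with the side of the square, and the affine part contributes
    nothing. *)
Lemma sqsum_small_near g e z : 0 < e -> cderivable g z ->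
  exists2 r : R, 0 < r & forall z0 u (x y : R), 0 <= x <= 1 -> 0 <= y <= 1 ->
    z = z0 + (x +i* y)%C * u -> modulus u < r -> sqsum_small g e z0 u.
Proof.
move=> e0 [d dP].
have [r r0 rP] := dP (e / 8) ltac:(lra).
exists (r / 2); first lra.
move=> z0 u x y x01 y01 zE ur; exists 0%N => N _.
have -> : sqsum g N z0 u = sqsum (fun s => g s - g z - d * (s - z)) N z0 u.
  transitivity (sqsum (fun s => (g s - g z - d * (s - z)) + (d * s + (g z - d * z))) N z0 u).
    by congr sqsum; apply: boolp.funext => s; ring.
  by rewrite sqsumD sqsum_affine addr0.
have -> : e * modulus u ^+ 2 = 4 * modulus u * (e / 8 * (2 * modulus u)) by field.
apply: sqsum_bound => x' y' x'01 y'01 _.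
set s := _ + _ * u.
have su : modulus (s - z) <= 2 * modulus u.
  have -> : s - z = ((x' - x)%:C%C + 'i%C * (y' - y)%:C%C) * u.
    rewrite zE /s (complexE (x' +i* y')%C) (complexE (x +i* y)%C) !rmorphB /=; ring.
  rewrite modulusM ler_wpM2r ?modulus_ge0//.
  apply: le_trans (modulusD _ _) _.
  rewrite modulusM modulus_i mul1r !modulus_real.
  have : `|x' - x| <= 1 by rewrite ler_norml; lra.
  have : `|y' - y| <= 1 by rewrite ler_norml; lra.
  lra.
apply: le_trans (rP _ _) _; first lra.
by rewrite ler_wpM2l; lra.
Qed.

Lemma half_expr_lt (a : R) : 0 < a ->
  exists k, forall j, (k <= j)%N -> 2^-1 ^+ j < a.
Proof.
move=> a0; exists (Num.bound a^-1) => j kj.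
rewrite exprVn -[ltRHS]invrK ltf_pV2 ?posrE ?invr_gt0 ?exprn_gt0//.
exact: upper_nthrootP.
Qed.

(** Goursat's bisection: a square on which the bound fails has a quarter on
    which it fails, and the nested squares so obtained shrink to a point, where
    [sqsum_small_near] is contradicted. *)
Theorem goursat g : (forall z, cderivable g z) ->
  forall e, 0 < e -> forall z u, sqsum_small g e z u.
Proof.
move=> gd e e0 z u; apply: contrapT => bad0.
pose bad k (p : R * R) := ~ sqsum_small g e (z + (p.1 +i* p.2)%C * u) ((2^-1 ^+ k)%:C%C * u).
(* The corner of the k-th square is recorded by its two real coordinates along
   [u] and ['i * u], which increase with k; their suprema locate the limit
   point. *)
have step k p : exists q : R * R, bad k p -> [/\ bad k.+1 q,
    p.1 <= q.1 <= p.1 + 2^-1 ^+ k.+1 & p.2 <= q.2 <= p.2 + 2^-1 ^+ k.+1].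
  have h0 : (0:R) <= 2^-1 ^+ k.+1 by rewrite exprn_ge0.
  set h := 2^-1 ^+ k.+1 in h0 *.
  apply: contrapT => /forallNP H.
  have badp : bad k p by apply: contrapT => nb; apply: (H p) => /nb.
  apply: badp.
  have {}H q : p.1 <= q.1 <= p.1 + h -> p.2 <= q.2 <= p.2 + h ->
      sqsum_small g e (z + (q.1 +i* q.2)%C * u) (h%:C%C * u).
    move=> q1 q2; apply: contrapT => nq; apply: (H q) => _; by split.
  have -> : (2^-1 ^+ k)%:C%C * u = h%:C%C * u + h%:C%C * u.
    rewrite -mulrDl -rmorphD /=; congr (_%:C%C * _); by rewrite /h exprS; field.
  have E (a b c d : R) : z + (a +i* b)%C * u + (c +i* d)%C * u = z + ((a + c) +i* (b + d))%C * u.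
    by rewrite -addrA -mulrDl.
  have Ei : 'i%C * (h%:C%C * u) = (0 +i* h)%C * u.
    by rewrite mulrA; congr (_ * u); apply/eqP; rewrite eq_complex /=; apply/andP; split; apply/eqP; ring.
  have := H p; have := H (p.1 + h, p.2); have := H (p.1, p.2 + h).
  have := H (p.1 + h, p.2 + h) => /= H4 H3 H2 H1.
  apply: sqsum_small_quadrisect.
  - by apply: H1; lra.
  - by rewrite E addr0; apply: H2; lra.
  - by rewrite Ei E addr0; apply: H3; lra.
  - by rewrite Ei !E !addr0; apply: H4; lra.
have {step} [F FP] : exists F : nat -> R * R -> R * R, forall k p, bad k p ->
   [/\ bad k.+1 (F k p), p.1 <= (F k p).1 <= p.1 + 2^-1 ^+ k.+1 & p.2 <= (F k p).2 <= p.2 + 2^-1 ^+ k.+1].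
  by exists (fun k p => sval (cid (step k p))) => k p; case: cid.
pose p := fix p k := if k is k'.+1 then F k' (p k') else (0, 0).
have badp k : bad k (p k).
  elim: k => [|k IH]; last by have [] := FP _ _ IH.
  rewrite /bad /= => H; apply: bad0.
  move: H; rewrite expr0 rmorph1 mul1r.
  have -> : (0 +i* 0)%C = 0 :> C by [].
  by rewrite mul0r addr0.
have lim (x : nat -> R) : x 0%N = 0 -> (forall k, x k <= x k.+1 <= x k + 2^-1 ^+ k.+1) ->
    exists X, forall k, x k <= X <= x k + 2^-1 ^+ k.
  move=> x0 xP.
  have mono k j : x k <= x (k + j)%N <= x k + 2^-1 ^+ k - 2^-1 ^+ (k + j).
    elim: j => [|j IH]; first by rewrite addn0; lra.
    rewrite addnS; have := xP (k + j)%N; rewrite exprS.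
    have : (0 : R) <= 2^-1 ^+ (k + j) by rewrite exprn_ge0.
    lra.
  have ub k : ubound (range x) (x k + 2^-1 ^+ k).
    move=> _ [j _ <-]; have [kj|jk] := leqP k j.
      have := mono k (j - k)%N; rewrite subnKC //.
      have : (0 : R) <= 2^-1 ^+ j by rewrite exprn_ge0.
      lra.
    have := mono j (k - j)%N; rewrite subnKC ?(ltnW jk) //.
    have : (0 : R) <= 2^-1 ^+ k by rewrite exprn_ge0.
    lra.
  exists (sup (range x)) => k; apply/andP; split.
    by apply: ub_le_sup; [exists (x 0%N + 2^-1 ^+ 0); exact: ub | exists k].
  by apply: ge_sup; [exists (x 0%N), 0%N | exact: ub].
have [X XP] := lim (fun k => (p k).1) erefl (fun k => let: And3 _ h _ := FP _ _ (badp k) in h).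
have [Y YP] := lim (fun k => (p k).2) erefl (fun k => let: And3 _ _ h := FP _ _ (badp k) in h).
have [r r0 rP] := sqsum_small_near e0 (gd (z + (X +i* Y)%C * u)).
have [k kP] : exists k, 2^-1 ^+ k * modulus u < r.
  have := modulus_ge0 u; rewrite le0r => /orP[/eqP->|u0]; first by exists 0%N; rewrite mulr0.
  have [k kP] := half_expr_lt (divr_gt0 r0 u0).
  by exists k; rewrite -ltr_pdivlMr// kP.
have h0 : (0 : R) < 2^-1 ^+ k by rewrite exprn_gt0.
apply: (badp k); apply: (rP _ _ ((X - (p k).1) / 2^-1 ^+ k) ((Y - (p k).2) / 2^-1 ^+ k)).
- by have := XP k => ?; rewrite divr_ge0 ?ler_pdivrMr ?mul1r; lra.
- by have := YP k => ?; rewrite divr_ge0 ?ler_pdivrMr ?mul1r; lra.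
- rewrite mulrA -addrA -mulrDl; congr (_ + _ * u).
  by apply/eqP; rewrite eq_complex /=; apply/andP; split; apply/eqP; field; rewrite ?lt0r_neq0.
- by rewrite modulusM modulus_real gtr0_norm.
Qed.

End Goursat.

(** * Complex differentiability in terms of moduli *)

Section Deriv.
Variable R : realType.
Local Notation C := (R[i] : numFieldType).

Lemma near_modulusP (V : normedModType C) (z : V) (P : V -> Prop) :
  (\forall s \near z, P s) <-> exists2 r : R, 0 < r & forall s, modulus (s - z) < r -> P s.
Proof.
split=> [/nbhs_normP[e /= e0 eP]|[r r0 rP]].
  have eE : e = (complex.Re e)%:C%C by rewrite RRe_real// gtr0_real.
  exists (complex.Re e); first by rewrite -ltcR -eE.
  by move=> s sz; apply: eP => /=; rewrite -normrN opprB modulusE eE ltcR.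
apply/nbhs_normP; exists r%:C%C => /=; first by rewrite ltcR.
by move=> s /=; rewrite -normrN opprB modulusE ltcR => /rP.
Qed.

Lemma modulus_continuous (V : normedModType C) : continuous (fun x : V => modulus x : R).
Proof.
move=> x; apply/cvgrPdist_le => e e0; apply/near_modulusP; exists e => // s sx.
rewrite ler_norml.
have := modulusD (s - x) x; rewrite subrK.
have := modulusD (x - s) s; rewrite subrK (modulus_distC x s).
by lra.
Qed.

Lemma cderivableP (g : C -> C) (z : C) : differentiable g z <-> cderivable g z.
Proof.
split.
  move=> gz; exists (g^`()%classic z) => e e0.
  have /eqaddoP /(_ e%:C%C) := diff_locally gz.
  rewrite ltcR => /(_ e0) /near_modulusP[r r0 rP].
  exists r => // s sr.
  have := rP (s - z); rewrite subr0 => /(_ sr) /=.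
  rewrite !fctE /= diff1E// subrK !modulusE -rmorphM lecR => H.
  by rewrite -addrA -opprD mulrC.
move=> [d dP]; apply/derivable1_diffP.
apply/cvg_ex; exists d; apply/cvgrPdist_le => e e0.
have eE : e = (complex.Re e)%:C%C by rewrite RRe_real// gtr0_real.
have [r r0 rP] := dP (complex.Re e) ltac:(by rewrite -ltcR -eE).
apply/(near_modulusP (0 : C)); exists r => // h; rewrite subr0 => hr h0.
have hn0 : modulus h != 0 by rewrite modulus_eq0.
rewrite modulusE eE lecR /= -[h%:A]/(h * 1) mulr1.
have := rP (h + z); rewrite addrK => /(_ hr) H.
have -> : d - h^-1 *: (g (h + z) - g z) = - ((g (h + z) - g z - d * h) / h).
  by rewrite -[h^-1 *: _]/(h^-1 * _); field.
by rewrite modulusN modulusM modulusV ler_pdivrMr // modulus_gt0.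
Qed.

Definition square_quot (f : C -> C) (c s : C) : C := (f s - f c) ^+ 2 / (s - c).

(** At [c] itself, writing f(s) - f(c) = d (s - c) + q with q = o(s - c), the
    quotient is d^2 (s - c) + 2 d q + q^2 / (s - c), so its derivative is d^2. *)
Lemma square_quot_differentiable (f : C -> C) (c : C) :
  (forall s, differentiable f s) -> forall s, differentiable (square_quot f c) s.
Proof.
move=> df s; have [->|sc] := eqVneq s c; last first.
  have -> : square_quot f c = (f - cst (f c)) * (f - cst (f c)) * (fun t => (t - c)^-1).
    by apply: boolp.funext => t; rewrite /square_quot expr2.
  have dfc : differentiable (f - cst (f c)) s by exact: differentiableB.
  apply: differentiableM; first exact: differentiableM.
  apply: (@differentiableV _ _ (fun t : C => t - c)); last by rewrite subr_eq0.
  exact: (@differentiableB _ _ _ id (cst c)).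
apply/cderivableP; have /cderivableP[d dP] := df c.
exists (d ^+ 2) => e e0.
pose m := modulus d.
have m0 : 0 <= m by exact: modulus_ge0.
pose e1 := e / (2 * m + 1 + e).
have e10 : 0 < e1 by rewrite divr_gt0//; lra.
have [r r0 rP] := dP _ e10.
exists r => // t tr.
have [->|tc] := eqVneq t c; first by rewrite !subrr mulr0 subr0 modulus0 mulr0.
have tc0 : t - c != 0 by rewrite subr_eq0.
rewrite /square_quot.
set a := t - c in tc0 *.
set q := f t - f c - d * a.
have -> : (f t - f c) ^+ 2 / a - (f c - f c) ^+ 2 / (c - c) - d ^+ 2 * a = 2 * d * q + q ^+ 2 / a.
  rewrite subrr expr0n /= mul0r subr0.
  have -> : f t - f c = d * a + q by rewrite /q; ring.
  by field.
have a0 : 0 < modulus a by rewrite modulus_gt0.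
have qa : modulus q <= e1 * modulus a by exact: rP.
have e1e : e1 * (2 * m + 1 + e) = e by rewrite /e1 divfK // lt0r_neq0 //; lra.
apply: le_trans (modulusD _ _) _.
rewrite expr2 !modulusM modulusV -/m.
have -> : modulus (2 : C) = 2 by rewrite -(rmorph_nat (real_complex R)) modulus_real ger0_norm.
have q2 : modulus q * modulus q / modulus a <= e1 * (e1 * modulus a).
  have E : e1 * (e1 * modulus a) * modulus a = e1 * modulus a * (e1 * modulus a) by ring.
  by rewrite ler_pdivrMr// E ler_pM ?modulus_ge0.
have : e1 <= 1 by rewrite ler_pdivrMr; lra.
set A := modulus a in qa q2 a0 *; set Q := modulus q in qa q2 *.
move=> e11.
have e1A : 0 <= e1 * A by rewrite mulr_ge0; lra.
have h1 : 2 * m * Q <= 2 * m * (e1 * A) by rewrite ler_wpM2l; lra.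
have h2 : e1 * (e1 * A) <= 1 * (e1 * A) by rewrite ler_wpM2r.
have h3 : 0 <= e1 * A * e by rewrite mulr_ge0; lra.
have -> : e * A = e1 * A * (2 * m + 1 + e) by rewrite -{1}e1e; ring.
lra.
Qed.

End Deriv.

(** * Maximum principle for entire functions *)

Section MaxPrinciple.
Variable R : realType.
Local Notation C := (R[i] : numFieldType).

Lemma Im_div (a b c d : R) :
  complex.Im ((a +i* b)%C * ((c +i* d)%C)^-1) = (b * c - a * d) / (c ^+ 2 + d ^+ 2).
Proof. by rewrite /=; ring. Qed.

(** The trapezoidal counterpart of the value 2 pi i of the integral of 1/s around
    the origin: only its being bounded away from 0 matters, and each of the four
    sides contributes at least 1 to the imaginary part. *)
Lemma sqsum_inv_Im (h : R) N : 0 < h ->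
  4 <= complex.Im (sqsum (fun s => s^-1) N (- h -i* h)%C (2 * h)%:C%C).
Proof.
move=> h0.
have side (a b : R) : (-1 <= a <= 1) -> (-1 <= b <= 1) ->
    [|| a == -1, a == 1, b == -1 | b == 1] -> 
    0 < (h * a) ^+ 2 + (h * b) ^+ 2 <= 2 * h ^+ 2.
  move=> a1 b1 ab.
  have a2 : a ^+ 2 <= 1 by nra.
  have b2 : b ^+ 2 <= 1 by nra.
  have ab2 : 1 <= a ^+ 2 + b ^+ 2.
    by case/or4P: ab => /eqP->; nra.
  rewrite !exprMn -mulrDr; have h2 : 0 < h ^+ 2 by rewrite exprn_gt0.
  apply/andP; split; first by rewrite mulr_gt0//; lra.
  by rewrite mulrC ler_wpM2r; lra.
have iu : 'i%C * (2 * h)%:C%C = (0 +i* (2 * h))%C :> R[i].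
  by apply/eqP; rewrite eq_complex /=; apply/andP; split; apply/eqP; ring.
have seg z (u : R[i]) : (forall t : R, 0 <= t <= 1 -> 1 <= complex.Im (u * (z + t%:C%C * u)^-1)) ->
  1 <= complex.Im (segsum (fun s => s^-1) N z u) by exact: segsum_Im_ge.
have segN z (u : R[i]) : (forall t : R, 0 <= t <= 1 -> 1 <= - complex.Im (u * (z + t%:C%C * u)^-1)) ->
  1 <= - complex.Im (segsum (fun s => s^-1) N z u).
  move=> H.
  have ImN (a : R[i]) : - complex.Im a = complex.Im (- a) by case: a.
  rewrite ImN -mulN1r -segsumZ; apply: segsum_Im_ge => t t01.
  by rewrite mulN1r mulrN -ImN; exact: H.
have pt (a b c d t : R) : ((a +i* b) + t%:C * (c +i* d) = (a + t * c) +i* (b + t * d) :> R[i])%C.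
  by apply/eqP; rewrite eq_complex /=; apply/andP; split; apply/eqP; ring.
have ImD (a b : R[i]) : complex.Im (a + b) = complex.Im a + complex.Im b by case: a b => [? ?] [].
have ImN (a : R[i]) : complex.Im (- a) = - complex.Im a by case: a.
have pD (a b c d : R) : ((a +i* b) + (c +i* d) = (a + c) +i* (b + d) :> R[i])%C by [].
rewrite /sqsum iu !ImD !ImN.
have -> : (2 * h)%:C%C = ((2 * h) +i* 0)%C :> R[i] by [].
have H1 : 1 <= complex.Im (segsum (fun s => s^-1) N (- h -i* h)%C ((2 * h) +i* 0)%C).
  apply: seg => t t01; rewrite pt Im_div.
  have := side (2 * t - 1) (-1) ltac:(lra) ltac:(lra).
  rewrite eqxx !orbT => /(_ isT) /andP[].
  have -> : - h + t * (2 * h) = h * (2 * t - 1) by ring.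
  have -> : - h + t * 0 = h * -1 by ring.
  set n := _ + _ => n0 n1; rewrite ler_pdivlMr // mul1r.
  by apply: le_trans n1 _; rewrite le_eqVlt; apply/orP; left; apply/eqP; ring.
have H2 : 1 <= complex.Im (segsum (fun s => s^-1) N ((- h -i* h) + ((2 * h) +i* 0))%C (0 +i* (2 * h))%C).
  rewrite pD; apply: seg => t t01; rewrite pt Im_div.
  have := side 1 (2 * t - 1) ltac:(lra) ltac:(lra).
  rewrite eqxx !orbT => /(_ isT) /andP[].
  have -> : - h + 2 * h + t * 0 = h * 1 by ring.
  have -> : - h + 0 + t * (2 * h) = h * (2 * t - 1) by ring.
  set n := _ + _ => n0 n1; rewrite ler_pdivlMr // mul1r.
  by apply: le_trans n1 _; rewrite le_eqVlt; apply/orP; left; apply/eqP; ring.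
have H3 : 1 <= - complex.Im (segsum (fun s => s^-1) N ((- h -i* h) + (0 +i* (2 * h)))%C ((2 * h) +i* 0)%C).
  rewrite pD; apply: segN => t t01; rewrite pt Im_div.
  have := side (2 * t - 1) 1 ltac:(lra) ltac:(lra).
  rewrite eqxx !orbT => /(_ isT) /andP[].
  have -> : - h + 0 + t * (2 * h) = h * (2 * t - 1) by ring.
  have -> : - h + 2 * h + t * 0 = h * 1 by ring.
  set n := _ + _ => n0 n1; rewrite -mulNr ler_pdivlMr // mul1r.
  by apply: le_trans n1 _; rewrite le_eqVlt; apply/orP; left; apply/eqP; ring.
have H4 : 1 <= - complex.Im (segsum (fun s => s^-1) N (- h -i* h)%C (0 +i* (2 * h))%C).
  apply: segN => t t01; rewrite pt Im_div.
  have := side (-1) (2 * t - 1) ltac:(lra) ltac:(lra).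
  rewrite eqxx => /(_ isT) /andP[].
  have -> : - h + t * (2 * h) = h * (2 * t - 1) by ring.
  have -> : - h + t * 0 = h * -1 by ring.
  set n := _ + _ => n0 n1; rewrite -mulNr ler_pdivlMr // mul1r.
  by apply: le_trans n1 _; rewrite le_eqVlt; apply/orP; left; apply/eqP; ring.
lra.
Qed.

(** With I, A, B the contour sums of 1/s, f/s and f^2/s, [goursat] for
    (f(s) - f(0))^2 / s makes f(0)^2 I - 2 f(0) A + B arbitrarily small, while
    |I| >= 4, |A| <= 8 M and |B| <= 8 M^2; this quadratic inequality bounds
    |f(0)| by a multiple of M. The contour is the square of half-side [h] centred
    at the origin, which lies in the shell of the hypothesis. *)
Theorem max_principle (f : C -> C) (h M : R) : 0 < h ->
  (forall s, differentiable f s) ->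
  (forall s, h <= modulus s <= 2 * h -> modulus (f s) <= M) ->
  modulus (f 0) <= 5 * M.
Proof.
move=> h0 df fM.
have M0 : 0 <= M.
  apply: le_trans (modulus_ge0 _) (fM h%:C%C _).
  by rewrite modulus_real gtr0_norm//; lra.
rewrite leNgt; apply/negP => x5; set x := modulus (f 0) in x5.
(* With the tolerance [x ^+ 2 / 4] for the whole contour sum, the outcome is
   [4 * x ^+ 2 <= x ^+ 2 / 4 + 16 * x * M + 8 * M ^+ 2], false for [x > 5 * M]. *)
have e0 : 0 < x ^+ 2 / 4 / (2 * h) ^+ 2 by rewrite !divr_gt0 ?exprn_gt0//; lra.
have dF : forall s, cderivable (square_quot f 0) s.
  by move=> s; apply/cderivableP; exact: square_quot_differentiable.
pose z : R[i] := (- h -i* h)%C; pose u : R[i] := (2 * h)%:C%C.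
have modu : modulus u = 2 * h by rewrite modulus_real gtr0_norm//; lra.
have [N /(_ N (leqnn N))] := goursat dF e0 z u.
rewrite modu divfK ?lt0r_neq0 ?exprn_gt0//; last lra.
have contour (p : R[i] -> R[i]) K : (forall s, h <= modulus s <= 2 * h -> modulus (p s) <= K) ->
    modulus (sqsum (fun s => p s / s) N z u) <= 8 * K.
  move=> pK.
  have -> : 8 * K = 4 * modulus u * (K / h) by rewrite modu; field; rewrite lt0r_neq0.
  apply: sqsum_bound => a b a01 b01 ab.
  set s := _ + _.
  have sE : s = ((2 * a - 1) * h +i* ((2 * b - 1) * h))%C.
    by apply/eqP; rewrite eq_complex /=; apply/andP; split; apply/eqP; ring.
  have hs : h <= modulus s.
    have hh : h = `|h| by rewrite gtr0_norm.
    case/or4P: ab => /eqP E.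
    - apply: le_trans (modulus_Re s); rewrite sE /= E.
      have -> : (2 * 0 - 1) * h = - h by ring.
      by rewrite normrN -hh.
    - apply: le_trans (modulus_Re s); rewrite sE /= E.
      have -> : (2 * 1 - 1) * h = h by ring.
      by rewrite -hh.
    - apply: le_trans (modulus_Im s); rewrite sE /= E.
      have -> : (2 * 0 - 1) * h = - h by ring.
      by rewrite normrN -hh.
    - apply: le_trans (modulus_Im s); rewrite sE /= E.
      have -> : (2 * 1 - 1) * h = h by ring.
      by rewrite -hh.
  have sh : modulus s <= 2 * h.
    apply: le_trans (modulus_le_ReIm s) _; rewrite sE /=.
    have abs (t : R) : 0 <= t <= 1 -> `|(2 * t - 1) * h| <= h.
      by move=> t01; rewrite ler_norml; nra.
    by have := abs a a01; have := abs b b01; lra.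
  rewrite modulusM modulusV ler_pM ?invr_ge0 ?modulus_ge0//.
    by apply: pK; rewrite hs.
  by rewrite lef_pV2 ?posrE//; lra.
have A8 := contour f M fM.
have B8 : modulus (sqsum (fun s => f s ^+ 2 / s) N z u) <= 8 * M ^+ 2.
  apply: contour => s hs; rewrite !expr2 modulusM.
  by rewrite ler_pM ?modulus_ge0 ?fM.
have I4 := sqsum_inv_Im N h0.
have FE : square_quot f 0 = fun s => (f 0 ^+ 2 * s^-1 + (- (2 * f 0)) * (f s / s)) + f s ^+ 2 / s.
  by apply: boolp.funext => s; rewrite /square_quot subr0; ring.
rewrite FE !sqsumD !sqsumZ.
set I := sqsum (fun s => s^-1) N z u in I4 *.
set A := sqsum (fun s => f s / s) N z u in A8 *.
set B := sqsum _ N z u in B8 *.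
move=> S.
have I4' : 4 <= modulus I.
  by apply: le_trans (modulus_Im I); apply: le_trans I4 (ler_norm _).
have T : x ^+ 2 * modulus I <= x ^+ 2 / 4 + 2 * x * modulus A + modulus B.
  have -> : x ^+ 2 * modulus I = modulus (f 0 ^+ 2 * I) by rewrite !expr2 !modulusM.
  have -> : 2 * x * modulus A = modulus (- (2 * f 0) * A).
    by rewrite modulusM modulusN modulusM -(rmorph_nat (real_complex R)) modulus_real ger0_norm.
  set p := f 0 ^+ 2 * I in S *; set q := - (2 * f 0) * A in S *.
  have -> : p = (p + q + B) - B - q by ring.
  have := modulusB (p + q + B - B) q.
  have := modulusB (p + q + B) B.
  lra.
have x0 : 0 < x by lra.
have t1 : x ^+ 2 * 4 <= x ^+ 2 * modulus I by rewrite ler_wpM2l ?sqr_ge0.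
have t2 : 2 * x * modulus A <= 2 * x * (8 * M) by rewrite ler_wpM2l//; lra.
nra.
Qed.
End MaxPrinciple.

(** * Hoelder estimate and row vectors *)

Section Hoelder.
Variable R : realType.
Local Notation C := (R[i] : numFieldType).

(** A substitute for the Schwarz lemma: the maximum principle is applied to
    (f(s) - f(1))^2 / (s - 1), whose value at 0 has modulus |f(0) - f(1)|^2 and
    which is small, of order 1/h, on a contour at distance about [h]. The price
    of squaring is the exponent 1/2. *)
Lemma entire_hoelder (f : C -> C) (h M : R) : 2 <= h ->
  (forall s, differentiable f s) ->
  (forall s, modulus s <= 2 * h -> modulus (f s) <= M) ->
  modulus (f 0 - f 1) ^+ 2 <= 40 * M ^+ 2 / h.
Proof.
move=> h2 df fM.
have h0 : 0 < h by lra.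
have m1 : modulus (1 : C) = 1 by rewrite -(rmorph1 (real_complex R)) modulus_real normr1.
have -> : 40 * M ^+ 2 / h = 5 * (8 * M ^+ 2 / h) by ring.
have -> : modulus (f 0 - f 1) ^+ 2 = modulus (square_quot f 1 0).
  by rewrite /square_quot !expr2 !modulusM modulusV sub0r modulusN m1 invr1 mulr1.
apply: (max_principle h0); first exact: square_quot_differentiable.
move=> s /andP[hs sh].
have h1s : h / 2 <= modulus (s - 1).
  have := modulusD (s - 1) 1; rewrite subrK m1; lra.
rewrite /square_quot expr2 !modulusM modulusV.
have -> : 8 * M ^+ 2 / h = (2 * M) * (2 * M) * (h / 2)^-1.
  by field; rewrite lt0r_neq0.
have dM : modulus (f s - f 1) <= 2 * M.
  apply: le_trans (modulusB _ _) _.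
  have := fM s sh; have := fM 1; rewrite m1 => /(_ ltac:(lra)); lra.
apply: ler_pM; rewrite ?invr_ge0 ?modulus_ge0 ?mulr_ge0 ?modulus_ge0//.
  by apply: ler_pM; rewrite ?modulus_ge0.
by rewrite lef_pV2 ?posrE//; lra.
Qed.
End Hoelder.

Section Rows.
Variables (R : realType) (n : nat).
Local Notation C := (R[i] : numFieldType).
Local Notation V := 'rV[C]_n.
Implicit Types x y w : V.

Lemma modulusZ (a : C) y : modulus (a *: y) = modulus a * modulus y.
Proof. by apply: complexI; rewrite rmorphM /= -!modulusE normrZ. Qed.

Lemma modulus_coord y i : modulus (y 0 i) <= modulus y.
Proof.
rewrite -lecR -!modulusE.
have -> : `|y| = mx_norm y by [].
rewrite mx_normE -[leLHS]nngE num_le.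
exact: (le_bigmax _ (fun ij : 'I_1 * 'I_n => `|y ij.1 ij.2|%:nng) (0, i)).
Qed.

Lemma modulus_le_coord y (M : R) : 0 <= M ->
  (forall i, modulus (y 0 i) <= M) -> modulus y <= M.
Proof.
move=> M0 yM; rewrite -lecR -modulusE.
have -> : `|y| = mx_norm y by [].
have [->|] := eqVneq (mx_norm y) 0; first by rewrite ler0c.
by move=> /mx_norm_neq0[[a b] ->] /=; rewrite ord1 modulusE lecR.
Qed.

Lemma line_differentiable (X : set V) (phi : V -> V) y w i :
  holomorphic_on X phi -> (forall s : C, X (y + s *: w)) ->
  forall s : C, differentiable (fun s : C => phi (y + s *: w) 0 i : C) s.
Proof.
move=> hphi Xl s.
apply: (@differentiable_comp _ _ _ _ (fun s : C => phi (y + s *: w)) (fun v : V => v 0 i : C)); last first.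
  exact: differentiable_coord.
apply: (@differentiable_comp _ _ _ _ (fun s : C => y + s *: w) phi); last exact: hphi.
apply: (@differentiableD _ _ _ (cst y) (fun s : C => s *: w)) => //.
Qed.

(** Squares rather than discs, since a square of [R[i]] is directly the image of
    a product of segments. *)
Lemma compact_polysquare (c : R) :
  compact [set x : V | forall i, `|complex.Re (x 0 i)| <= c /\ `|complex.Im (x 0 i)| <= c].
Proof.
pose A : set C := [set z | `|complex.Re z| <= c /\ `|complex.Im z| <= c].
apply: (@rV_compact C n (fun=> A)) => _.
have -> : A = (fun p : R * R => p.1%:C%C + 'i%C * p.2%:C%C : C) @` (`[- c, c] `*` `[- c, c]).
  apply/seteqP; split=> [z [zr zi]|_ [[a b] /= [a1 b1] <-]].
    exists (complex.Re z, complex.Im z); last by rewrite /= -complexE.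
    by split; rewrite /= in_itv /= -ler_norml.
  rewrite /A /=; move: a1 b1; rewrite !in_itv /= -!ler_norml => a1 b1.
  split.
    by have -> : a + (0 * b - 1 * 0) = a by ring.
  by have -> : 0 + (0 * 0 + 1 * b) = b by ring.
apply: continuous_compact; last by apply: compact_setX; exact: segment_compact.
have rc : continuous (fun a : R => a%:C%C : C).
  move=> a; apply/cvgrPdist_le => e e0.
  have eE : e = (complex.Re e)%:C%C by rewrite RRe_real// gtr0_real.
  have e0' : 0 < complex.Re e by rewrite -ltcR -eE.
  near=> b.
  rewrite -rmorphB modulusE modulus_real eE lecR.
  near: b; exact: cvgr_dist_le.
apply: continuous_subspaceT => p; apply: cvgD.
  apply: (@cvg_comp _ _ _ fst (fun a : R => a%:C%C : C)); [exact: cvg_fst | exact: rc].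
apply: cvgM; first exact: cvg_cst.
apply: (@cvg_comp _ _ _ snd (fun a : R => a%:C%C : C)); [exact: cvg_snd | exact: rc].
Unshelve. all: by end_near. Qed.

End Rows.

(** * Holomorphic maps on the punctured space *)

Section Punctured.
Variables (R : realType) (n : nat).
Hypothesis n2 : (2 <= n)%N.
Local Notation C := (R[i] : numFieldType).
Local Notation V := 'rV[C]_n.
Implicit Types x y w : V.
Local Notation X := (~` [set 0] : set V).

(** Large both near infinity and near the origin, the two ends of [X]. *)
Definition end_gauge x : R := modulus x + (modulus x)^-1.

Lemma modulus_sq_le_coord y (K : R) : 0 <= K ->
  (forall i, modulus (y 0 i) ^+ 2 <= K) -> modulus y ^+ 2 <= K.
Proof.
move=> K0 yK.
have le_sqrt (t : R) : 0 <= t -> t ^+ 2 <= K -> t <= Num.sqrt K.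
  by move=> t0 tK; rewrite -(ger0_norm t0) -sqrtr_sqr ler_sqrt.
rewrite -(sqr_sqrtr K0) lerXn2r ?nnegrE ?modulus_ge0 ?sqrtr_ge0//.
apply: modulus_le_coord; first exact: sqrtr_ge0.
by move=> i; apply: le_sqrt; rewrite ?modulus_ge0.
Qed.

(** A sublevel set is described by |x|^2 + 1 <= c |x|, which is a closed
    condition on the whole space and excludes the origin by itself. *)
Lemma punctured_exhaustion : exhaustion X end_gauge.
Proof.
have cm : continuous (fun x : V => modulus x : R) by exact: modulus_continuous.
split.
- by move=> x _; rewrite addr_ge0 ?invr_ge0 ?modulus_ge0.
- apply: continuous_in_subspaceT => x /[!inE] x0.
  apply: (@continuous_comp _ _ _ (fun x : V => modulus x : R) (fun t => t + t^-1)); first exact: cm.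
  by apply: cvgD; [exact: cvg_id | apply: cvgV; [rewrite modulus_eq0; exact/eqP | exact: cvg_id]].
move=> c.
have -> : [set x | X x /\ end_gauge x <= c] =
    (fun x : V => modulus x ^+ 2 + 1 - c * modulus x : R) @^-1` [set t | t <= 0].
  apply/seteqP; split=> x /=.
    move=> [/eqP x0]; have m0 : 0 < modulus x by rewrite modulus_gt0.
    rewrite /end_gauge => H.
    have : (modulus x + (modulus x)^-1) * modulus x <= c * modulus x by rewrite ler_wpM2r // ltW.
    rewrite mulrDl mulVf ?lt0r_neq0//; lra.
  move=> H.
  have m0 : 0 < modulus x.
    rewrite lt_neqAle modulus_ge0 andbT; apply/eqP => m0.
    by move: H; rewrite -m0; lra.
  split; first by apply/eqP; rewrite -modulus_gt0.
  rewrite /end_gauge -(ler_pM2r m0) mulrDl mulVf ?lt0r_neq0//; lra.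
apply: (subclosed_compact _ (@compact_polysquare R n c)).
  apply: closed_comp; last exact: closed_le.
  move=> x _.
  apply: (@continuous_comp _ _ _ (fun x : V => modulus x : R) (fun t => t ^+ 2 + 1 - c * t)); first exact: cm.
  apply: cvgB; last by apply: cvgM; [exact: cvg_cst|exact: cvg_id].
  by apply: cvgD; [exact: (@exprn_continuous _ 2) | exact: cvg_cst].
move=> x /= H i.
have mc : modulus x <= c.
  have := modulus_ge0 x; rewrite le0r => /orP[/eqP m0|m0].
    by move: H; rewrite m0; lra.
  by rewrite -(ler_pM2r m0); lra.
have := modulus_coord x i => h.
by split; [have := modulus_Re (x 0 i)|have := modulus_Im (x 0 i)]; lra.
Qed.

Lemma other_coord (i : 'I_n) : exists j : 'I_n, j != i.
Proof.
have [i0|i0] := eqVneq (i : nat) 0%N.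
  by exists (Ordinal n2); apply/eqP => /(congr1 val) /=; rewrite i0.
have n0 : (0 < n)%N by lia.
by exists (Ordinal n0); apply/eqP => /(congr1 val) /= E; rewrite -E in i0.
Qed.

Lemma nonzero_coord y : y != 0 -> exists i, y 0 i != 0.
Proof.
move=> y0; apply: contrapT => /forallNP H; move/eqP: y0; apply.
by apply/rowP => i; rewrite mxE; apply/eqP; apply: contrapT => /negP; exact: H.
Qed.

Lemma modulus_delta (j : 'I_n) : modulus (delta_mx 0 j : V) = 1.
Proof.
have m1 : modulus (1 : C) = 1 by rewrite -(rmorph1 (real_complex R)) modulus_real normr1.
apply/eqP; rewrite eq_le; apply/andP; split.
  apply: modulus_le_coord => // i; rewrite mxE eqxx /=.
  by case: (i == j); rewrite ?m1 ?modulus0.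
by rewrite -m1; have := modulus_coord (delta_mx 0 j : V) j; rewrite mxE !eqxx.
Qed.

(** Hartogs' phenomenon. If the i-th coordinate of [y] is nonzero and [j] is
    another index, the line through [y] in direction e_j avoids the origin, and
    its points with parameter between 2 and 4 in modulus lie in the compact shell
    1 <= |x| <= 5. *)
Lemma holomorphic_bounded (phi : V -> V) : holomorphic_on X phi ->
  exists M : R, forall y, y != 0 -> modulus y <= 1 -> modulus (phi y) <= M.
Proof.
move=> hphi.
have [M MP] : exists M : R, forall x, 1 <= modulus x <= 5 -> modulus (phi x) <= M.
  have [_ _ /(_ 6) K6] := punctured_exhaustion.
  have : compact ((fun x => modulus (phi x) : R) @` [set x | X x /\ end_gauge x <= 6]).
    apply: continuous_compact => //; apply: continuous_in_subspaceT => x /[!inE] -[x0 _].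
    apply: (@continuous_comp _ _ _ phi (fun v : V => modulus v : R)); last exact: modulus_continuous.
    by apply: differentiable_continuous; exact: hphi.
  move=> /compact_bounded[M [_ MP]]; exists (M + 1) => x x15.
  have m0 : 0 < modulus x by lra.
  have := MP (M + 1) ltac:(lra) (modulus (phi x)) => /(_ _)/(le_trans (ler_norm _)); apply.
  exists x => //; split; first by apply/eqP; rewrite -modulus_gt0.
  have : (modulus x)^-1 <= 1 by rewrite invf_le1//; lra.
  by rewrite /end_gauge; lra.
have M0 : 0 <= M.
  have [j _] := other_coord (Ordinal n2).
  apply: le_trans (modulus_ge0 _) (MP (delta_mx 0 j) _).
  by rewrite modulus_delta; lra.
exists (5 * M) => y y0 y1.
have [i yi] := nonzero_coord y0.
have [j ji] := other_coord i.
pose w : V := delta_mx 0 j.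
have lX (s : C) : X (y + s *: w).
  move=> /(congr1 (fun v : V => v 0 i)); rewrite !mxE eqxx eq_sym (negbTE ji) mulr0 addr0.
  by move/eqP; rewrite (negbTE yi).
apply: modulus_le_coord => [|l]; first lra.
have -> : y = y + 0 *: w by rewrite scale0r addr0.
apply: (@max_principle _ (fun s : C => phi (y + s *: w) 0 l) 2) => //.
  exact: (line_differentiable l hphi lX).
move=> s s2; apply: le_trans (modulus_coord _ _) _; apply: MP; apply/andP; split.
  apply: le_trans (modulus_coord _ j); rewrite !mxE !eqxx mulr1.
  have := modulus_coord y j; have := modulusB (y 0 j + s) (y 0 j).
  by rewrite addrAC subrr add0r; lra.
apply: le_trans (modulusD _ _) _; rewrite modulusZ modulus_delta; lra.
Qed.

(** The parametrization of the line makes [y] and [y'] correspond to 0 and 1; the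
    points with parameter at most 1 / (2 |y - y'|) stay in the unit ball. *)
Lemma hoelder_line (phi : V -> V) (M : R) y y' : holomorphic_on X phi ->
  (forall y, y != 0 -> modulus y <= 1 -> modulus (phi y) <= M) ->
  (forall s : C, y + s *: (y' - y) != 0) ->
  modulus y <= 2^-1 -> modulus (y - y') <= 8^-1 ->
  modulus (phi y - phi y') ^+ 2 <= 160 * M ^+ 2 * modulus (y - y').
Proof.
move=> hphi phiM line yh dh.
have [->|neq] := eqVneq y y'; first by rewrite !subrr !modulus0 expr0n mulr0.
have d0 : 0 < modulus (y - y') by rewrite modulus_gt0 subr_eq0.
set d := modulus (y - y') in dh d0 *.
have d0' := lt0r_neq0 d0.
apply: modulus_sq_le_coord; first by apply: mulr_ge0 (ltW d0); apply: mulr_ge0 (sqr_ge0 _).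
move=> i; rewrite !mxE.
have -> : 160 * M ^+ 2 * d = 40 * M ^+ 2 / (4 * d)^-1 by rewrite invrK; ring.
pose f (s : C) := phi (y + s *: (y' - y)) 0 i.
have -> : phi y 0 i = f 0 by rewrite /f scale0r addr0.
have -> : phi y' 0 i = f 1 by rewrite /f scale1r addrC subrK.
apply: entire_hoelder.
- rewrite -[leLHS]invrK lef_pV2 ?posrE ?invr_gt0 ?mulr_gt0//.
  have -> : (2^-1 : R) = 4 * 8^-1 by field.
  by rewrite ler_wpM2l.
- by apply: (line_differentiable i hphi) => t; apply/eqP; exact: line.
move=> s sh; apply: le_trans (modulus_coord _ _) _; apply: phiM => //.
apply: le_trans (modulusD _ _) _; rewrite modulusZ (modulus_distC y') -/d.
have : modulus s * d <= 2 * (4 * d)^-1 * d by rewrite ler_wpM2r// ltW.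
have -> : 2 * (4 * d)^-1 * d = 2^-1 by field.
lra.
Qed.

(** If the line through [y] and [y'] hits the origin, the segment is replaced by
    the two sides of a triangle: the third vertex is [y] moved by |y - y'| in a
    coordinate direction, chosen so that neither side spans a line through the
    origin. *)
Lemma hoelder_near0 (phi : V -> V) : holomorphic_on X phi ->
  exists2 L : R, 0 <= L & forall y y', y != 0 -> y' != 0 ->
    modulus y <= 32^-1 -> modulus y' <= 32^-1 ->
    modulus (phi y - phi y') ^+ 2 <= L * modulus (y - y').
Proof.
move=> hphi; have [M phiM] := holomorphic_bounded hphi.
pose K := 160 * M ^+ 2.
have K0 : 0 <= K by rewrite mulr_ge0 ?sqr_ge0.
exists (6 * K); first lra.
move=> y y' y0 y'0 yh y'h.
have dh : modulus (y - y') <= 16^-1 by have := modulusB y y'; lra.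
have d0 := modulus_ge0 (y - y').
have [line|] := pselect (forall s : C, y + s *: (y' - y) != 0).
  apply: le_trans (hoelder_line hphi phiM line _ _) _; [lra|lra|].
  by rewrite ler_wpM2r// -/K; lra.
move=> /existsNP[s /negP/negPn/eqP ys].
set d := modulus (y - y') in dh d0 *.
have [i yi] := nonzero_coord y0.
have [j ji] := other_coord i.
pose y2 : V := y + d%:C%C *: delta_mx 0 j.
have dy2 : modulus (y - y2) = d.
  by rewrite /y2 opprD addrA subrr add0r modulusN modulusZ modulus_delta modulus_real ger0_norm// mulr1.
have dne : d != 0.
  apply/eqP => /eqP; rewrite modulus_eq0 subr_eq0 => /eqP yy.
  by move: ys; rewrite -yy subrr scaler0 addr0 => /eqP; rewrite (negbTE y0).
have ysc l : y 0 l + s * (y' 0 l - y 0 l) = 0.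
  by have := congr1 (fun v : V => v 0 l) ys; rewrite !mxE.
have l1 (t : C) : y + t *: (y2 - y) != 0.
  apply/eqP => /(congr1 (fun v : V => v 0 i)).
  rewrite /y2 addrAC subrr add0r !mxE eqxx eq_sym (negbTE ji) !mulr0 addr0.
  by move/eqP; rewrite (negbTE yi).
have l2 (t : C) : y2 + t *: (y' - y2) != 0.
  apply/eqP => H.
  have Hi : y 0 i + t * (y' 0 i - y 0 i) = 0.
    by have := congr1 (fun v : V => v 0 i) H; rewrite !mxE eqxx eq_sym (negbTE ji) !mulr0 addr0.
  have Hj : y 0 j + d%:C%C + t * (y' 0 j - (y 0 j + d%:C%C)) = 0.
    by have := congr1 (fun v : V => v 0 j) H; rewrite !mxE !eqxx !mulr1.
  have yy : y' 0 i - y 0 i != 0.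
    apply/eqP => E; have := ysc i; rewrite E mulr0 addr0 => /eqP.
    by rewrite (negbTE yi).
  have ts : t = s.
    apply: (mulIf yy); apply: (@addrI _ (y 0 i)); by rewrite Hi ysc.
  have s1 : s = 1.
    have : d%:C%C * (1 - s) = 0.
      by rewrite -[RHS](subrr 0) -{1}Hj -(ysc j) ts; ring.
    move/eqP; rewrite mulf_eq0 subr_eq0 => /orP[/eqP dd|/eqP//].
    by move/eqP: dne; case; apply: complexI; rewrite dd.
  by move: ys; rewrite s1 scale1r addrC subrK => /eqP; rewrite (negbTE y'0).
have dy2' : modulus (y2 - y') <= 2 * d.
  have -> : y2 - y' = (y2 - y) + (y - y') by rewrite addrA subrK.
  by apply: le_trans (modulusD _ _) _; rewrite modulus_distC dy2 -/d; lra.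
have y2h : modulus y2 <= 2^-1.
  have -> : y2 = y - (y - y2) by rewrite opprB addrC subrK.
  by have := modulusB y (y - y2); rewrite dy2; lra.
have H1 := hoelder_line hphi phiM l1 ltac:(lra) ltac:(lra).
have H2 := hoelder_line hphi phiM l2 ltac:(lra) ltac:(lra).
rewrite dy2 -/K in H1; rewrite -/K in H2.
have H3 : K * modulus (y2 - y') <= K * (2 * d) by rewrite ler_wpM2l.
have -> : phi y - phi y' = (phi y - phi y2) + (phi y2 - phi y') by rewrite addrA subrK.
have := modulusD (phi y - phi y2) (phi y2 - phi y').
set a := modulus _; set b := modulus _ in H1 *; set c := modulus _ in H2 *.
have a0 : 0 <= a by exact: modulus_ge0.
move=> abc.
have : a ^+ 2 <= (b + c) ^+ 2 by rewrite lerXn2r ?nnegrE// (le_trans a0).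
have : (b + c) ^+ 2 <= 2 * b ^+ 2 + 2 * c ^+ 2 by have := sqr_ge0 (b - c); nra.
lra.
Qed.

End Punctured.

(** * A sequence converging to the origin *)

Section ConvergingSequence.
Variables (R : realType) (n : nat).
Hypothesis n2 : (2 <= n)%N.
Local Notation C := (R[i] : numFieldType).
Local Notation V := 'rV[C]_n.
Implicit Types x y w : V.
Local Notation X := (~` [set 0] : set V).

Definition dyadic_pt (i : 'I_n) (k : nat) : V := (2^-1 ^+ k : R)%:C%C *: delta_mx 0 i.

Variable i : 'I_n.
Local Notation a k := (2^-1 ^+ k : R).

Lemma half_expr_gt0 k : 0 < a k.
Proof. by rewrite exprn_gt0. Qed.

Lemma dyadicB k l : modulus (dyadic_pt i k - dyadic_pt i l) = `|a k - a l|.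
Proof. by rewrite -scalerBl -rmorphB modulusZ modulus_delta// mulr1 modulus_real. Qed.

Lemma modulus_dyadic k : modulus (dyadic_pt i k) = a k.
Proof. by rewrite modulusZ modulus_delta// mulr1 modulus_real gtr0_norm ?half_expr_gt0. Qed.

Lemma dyadic_neq0 k : dyadic_pt i k != 0.
Proof. by rewrite -modulus_gt0 modulus_dyadic half_expr_gt0. Qed.

Lemma dyadic_inj : injective (dyadic_pt i).
Proof.
move=> k l /(congr1 (@modulus R V)); rewrite !modulus_dyadic.
by apply: ieexprIn; [lra | apply/eqP; lra].
Qed.

Lemma infinite_dyadic : infinite_set (range (dyadic_pt i)).
Proof.
move=> fD; apply: infinite_nat.
rewrite -(eq_finite_set (inj_card_eq (A := setT) (f := dyadic_pt i) _)) //.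
by move=> k l _ _; exact: dyadic_inj.
Qed.

Lemma infinite_sub_dyadic (T : set V) : infinite_set T -> T `<=` range (dyadic_pt i) ->
  forall K, exists2 k, (K <= k)%N & T (dyadic_pt i k).
Proof.
move=> infT TD K; apply: contrapT => H; apply: infT.
apply: (sub_finite_set (B := dyadic_pt i @` `I_K)); last exact: finite_image.
move=> y Ty; have [k _ yk] := TD y Ty; exists k => //=.
by rewrite ltnNge; apply/negP => Kk; apply: H; exists k; rewrite // yk.
Qed.

(** Only finitely many points of the sequence have norm at least |x| / 2, and a
    finite set has no limit point. *)
Lemma discrete_dyadic : discrete_in X (range (dyadic_pt i)).
Proof.
split; first by move=> _ [k _ <-]; apply/eqP; exact: dyadic_neq0.
move=> x /eqP x0 lx.
have m0 : 0 < modulus x by rewrite modulus_gt0.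
have [K KP] := half_expr_lt (divr_gt0 m0 (ltr0n _ 2)).
pose S : set V := (dyadic_pt i @` `I_K) `\ x.
have clS : closed S.
  apply: (iffLR accessible_finite_set_closed).
    by apply: hausdorff_accessible; exact: norm_hausdorff.
  by apply: finite_setD; exact: finite_image.
have nS : nbhs x (~` S).
  by apply: open_nbhs_nbhs; split; [exact: closed_openC | move=> [_]; apply].
have nB : nbhs x [set y : V | modulus x / 2 < modulus y].
  apply/(@near_modulusP R V); exists (modulus x / 2); first by rewrite divr_gt0.
  by move=> s /= sx; have := modulusB s (s - x); rewrite opprB addrC subrK; lra.
have [y [yx [k _ yk] [Sy By]]] := lx _ (filterI nS nB).
subst y.
have [kK|Kk] := ltnP k K.
  by apply: Sy; split; [exists k | exact/eqP].
by move: By; rewrite /= modulus_dyadic; have := KP k Kk; lra.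
Qed.

Lemma scale_bounds (t M L : R) : 0 < t -> 0 <= M -> 0 <= L ->
  t < (4 + 2 * M + 16 * L)^-1 ->
  [/\ t <= 4^-1, 2 * t ^+ 3 <= 32^-1 & t * (16 * L) < 1].
Proof.
move=> t0 M0 L0.
have p0 : 0 < 4 + 2 * M + 16 * L by lra.
rewrite -[X in _ < X]mul1r ltr_pdivlMr // => tp.
have tM : 0 <= t * M by rewrite mulr_ge0 // ltW.
have tL : 0 <= t * L by rewrite mulr_ge0 // ltW.
have t4 : t <= 4^-1 by lra.
have : t ^+ 3 <= 4^-1 ^+ 3 by rewrite lerXn2r ?nnegrE //; lra.
by split; lra.
Qed.

(** As [m] stays below [M], most of the cube has to come from [m^-1]. *)
Lemma inv_cube_bound (t m M : R) : 0 < t -> 0 < m -> m <= M ->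
  t <= 4^-1 -> t < (4 + 2 * M)^-1 -> t^-1 ^+ 3 <= m + m^-1 -> m <= 2 * t ^+ 3.
Proof.
move=> t0 m0 mM t4.
have p0 : 0 < 4 + 2 * M by lra.
rewrite -[X in X < _]invrK ltf_pV2 ?posrE ?invr_gt0//.
set b := t^-1 => bM H.
have b1 : 1 <= b by lra.
have b3 : b <= b ^+ 3 by rewrite -{1}(expr1 b) ler_weXn2l.
have mb : b ^+ 3 / 2 <= m^-1 by lra.
have -> : 2 * t ^+ 3 = (b ^+ 3 / 2)^-1.
  by rewrite invf_div /b; field; rewrite lt0r_neq0.
have b30 : 0 < b ^+ 3 / 2 by apply: divr_gt0 => //; apply: exprn_gt0; lra.
by rewrite -[leLHS]invrK lef_pV2 ?posrE ?invr_gt0.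
Qed.

Lemma cube_scale_absurd (t s d L : R) : 0 < t -> s <= t / 2 -> 0 <= L ->
  t * (16 * L) < 1 -> d <= 4 * t ^+ 3 -> (t - s) ^+ 2 <= L * d -> False.
Proof.
move=> t0 st L0 tL dt H.
have h1 : L * d <= L * (4 * t ^+ 3) by rewrite ler_wpM2l.
have h2 : (t / 2) ^+ 2 <= (t - s) ^+ 2 by rewrite lerXn2r ?nnegrE//; lra.
have h3 : t ^+ 2 * (t * (16 * L)) < t ^+ 2 * 1 by rewrite ltr_pM2l// exprn_gt0.
have e1 : L * (4 * t ^+ 3) = t ^+ 2 * (t * (16 * L)) / 4 by field.
have e2 : (t / 2) ^+ 2 = t ^+ 2 / 4 by field.
lra.
Qed.

(** The cube in the choice of zeta beats the square lost in [hoelder_near0]; any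
    exponent greater than 2 would do. *)
Lemma dyadic_not_tame (T : set V) : T `<=` range (dyadic_pt i) -> ~ tame X T.
Proof.
move=> TD [infT _ /(_ _ (@punctured_exhaustion R n))].
move=> /(_ (fun x => (modulus x)^-1 ^+ 3)) [].
  by move=> x _; rewrite exprn_ge0 ?invr_ge0 ?modulus_ge0.
move=> phi [[hphi phiX [psi [hpsi _ psiK _]]] phiP].
have [M phiM] := holomorphic_bounded n2 hphi.
have [L L0 psiL] := hoelder_near0 n2 hpsi.
have M0 : 0 <= M.
  apply: le_trans (modulus_ge0 _) (phiM (dyadic_pt i 0) (dyadic_neq0 _) _).
  by rewrite modulus_dyadic.
have c0 : 0 < (4 + 2 * M + 16 * L)^-1 by rewrite invr_gt0; lra.
have [K KP] := half_expr_lt c0.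
have small k : (K <= k)%N -> T (dyadic_pt i k) ->
    modulus (phi (dyadic_pt i k)) <= 2 * a k ^+ 3.
  move=> Kk Tk.
  have [ak4 _ _] := scale_bounds (half_expr_gt0 k) M0 L0 (KP k Kk).
  apply: (@inv_cube_bound _ _ M) => //.
  - by rewrite modulus_gt0; apply/eqP; apply: phiX; apply/eqP; exact: dyadic_neq0.
  - apply: phiM; first exact: dyadic_neq0.
    by rewrite modulus_dyadic (le_trans ak4)// invf_le1 ?ler1n.
  - by apply: lt_le_trans (KP k Kk) _; rewrite lef_pV2 ?posrE; lra.
  by have := phiP _ Tk; rewrite modulus_dyadic.
have [k Kk Tk] := infinite_sub_dyadic infT TD K.
have [l kl Tl] := infinite_sub_dyadic infT TD k.+1.
have lk : a l <= a k / 2.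
  have -> : a k / 2 = a k.+1 by rewrite exprS mulrC.
  by rewrite ler_wiXn2l// invf_le1 ?ler1n.
have yl := small l (leq_trans Kk (ltnW kl)) Tl.
have {small} yk := small k Kk Tk.
have XP m : phi (dyadic_pt i m) != 0.
  by apply/eqP; apply: phiX; apply/eqP; exact: dyadic_neq0.
have := psiL _ _ (XP k) (XP l).
rewrite !psiK; try (by apply/eqP; exact: dyadic_neq0).
rewrite dyadicB.
have [_ t32 tL] := scale_bounds (half_expr_gt0 k) M0 L0 (KP k Kk).
have dle := modulusB (phi (dyadic_pt i k)) (phi (dyadic_pt i l)).
move: (half_expr_gt0 k) (half_expr_gt0 l) lk yk yl dle t32 tL.
move: (a k) (a l) (modulus _) (modulus _) (modulus _) => t s d p q.
clear - L0 => t0 s0 st pt qs dpq t32 tL.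
have s3 : s ^+ 3 <= t ^+ 3 by rewrite lerXn2r ?nnegrE//; lra.
move=> /(_ ltac:(lra) ltac:(lra)).
rewrite ger0_norm; last lra.
by apply: cube_scale_absurd => //; lra.
Qed.
End ConvergingSequence.

Theorem corollary6p4 (R : realType) (n : nat) (hn : (2 <= n)%N) :
  let X : set (Cvec R n) := ~` [set 0] in
  exists D : set (Cvec R n),
    [/\ infinite_set D, discrete_in X D &
      ~ exists F : set (set (Cvec R n)),
          [/\ finite_set F, (forall T, F T -> tame X T) &
              D = \bigcup_(T in F) T]].
Proof.
move=> X; pose i := Ordinal hn.
exists (range (dyadic_pt R i)); split.
- exact: infinite_dyadic.
- exact: discrete_dyadic.
move=> [F [_ Ftame DF]].
have : range (dyadic_pt R i) (dyadic_pt R i 0) by exists 0%N.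
rewrite DF => -[T FT _].
apply: (dyadic_not_tame hn (i := i) _ (Ftame T FT)).
by rewrite DF; exact: bigcup_sup.
Qed.
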